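(* The functions $\mathbf{\Phi}_1,\mathbf{\Phi}_2,\mathbf{\Phi}_3$ satisfy the following $q$-difference equations with respect to their parameters. (i) For $q^\gamma\neq 1,q^{-1},q^{-2},\dots$, write $\mathbf{\Phi}_1(x,y)=\mathbf{\Phi}_{1}(q^{\alpha},q^{\beta};q^{\gamma};q,x,y)$ and $\mathbf{\Phi}_1^{+}(x,y)=\mathbf{\Phi}_{1}(q^{\alpha},q^{\beta};q^{\gamma+1};q,x,y)$. Then $$\mathbb{D}_{\alpha,q}\mathbf{\Phi}_{1}=-\frac{1}{1-q^{\alpha}}\Big[\mathbf{\Theta}_{x,q}\mathbf{\Phi}_{1}(x,y)+\mathbf{\Theta}_{y,q}\mathbf{\Phi}_{1}(qx,y)\Big],\quad q^\alpha\neq1,$$ $$\mathbb{D}_{\alpha,q}\mathbf{\Phi}_{1}=-\frac{1}{1-q^{\alpha}}\Big[\mathbf{\Theta}_{y,q}\mathbf{\Phi}_{1}(x,y)+\mathbf{\Theta}_{x,q}\mathbf{\Phi}_{1}(x,qy)\Big],\quad q^\alpha\neq1,$$ $$\mathbb{D}_{\beta,q}\mathbf{\Phi}_{1}=-\frac{1}{1-q^{\beta}}\mathbf{\Theta}_{x,q}\mathbf{\Phi}_{1}(x,y),\quad q^\beta\neq1,$$ $$\mathbb{D}_{\gamma,q}\mathbf{\Phi}_{1}=\frac{1}{1-q^{\gamma}}\Big[\mathbf{\Theta}_{x,q}\mathbf{\Phi}_{1}^{+}(x,y)+\mathbf{\Theta}_{y,q}\mathbf{\Phi}_{1}^{+}(qx,y)\Big],\quad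 q^\gamma\neq1,$$ $$\mathbb{D}_{\gamma,q}\mathbf{\Phi}_{1}=\frac{1}{1-q^{\gamma}}\Big[\mathbf{\Theta}_{y,q}\mathbf{\Phi}_{1}^{+}(x,y)+\mathbf{\Theta}_{x,q}\mathbf{\Phi}_{1}^{+}(x,qy)\Big],\quad q^\gamma\neq1.$$ (ii) For $q^\gamma\neq 1,q^{-1},q^{-2},\dots$, write $\mathbf{\Phi}_2(x,y)=\mathbf{\Phi}_{2}(q^{\alpha},q^{\beta};q^{\gamma};q,x,y)$ and $\mathbf{\Phi}_2^{+}(x,y)=\mathbf{\Phi}_{2}(q^{\alpha},q^{\beta};q^{\gamma+1};q,x,y)$. Then $$\mathbb{D}_{\alpha,q}\mathbf{\Phi}_{2}=-\frac{1}{1-q^{\alpha}}\mathbf{\Theta}_{x,q}\mathbf{\Phi}_{2}(x,y),\quad q^\alpha\neq1,$$ $$\mathbb{D}_{\beta,q}\mathbf{\Phi}_{2}=-\frac{1}{1-q^{\beta}}\mathbf{\Theta}_{y,q}\mathbf{\Phi}_{2}(x,y),\quad q^\beta\neq1,$$ $$\mathbb{D}_{\gamma,q}\mathbf{\Phi}_{2}=\frac{1}{1-q^{\gamma}}\Big[\mathbf{\Theta}_{x,q}\mathbf{\Phi}_{2}^{+}(x,y)+\mathbf{\Theta}_{y,q}\mathbf{\Phi}_{2}^{+}(qx,y)\Big],\quad q^\gamma\neq1,$$ $$\mathbb{D}_{\gamma,q}\mathbf{\Phi}_{2}=\frac{1}{1-q^{\gamma}}\Big[\mathbf{\Theta}_{y,q}\mathbf{\Phi}_{2}^{+}(x,y)+\mathbf{\Theta}_{x,q}\mathbf{\Phi}_{2}^{+}(x,qy)\Big],\quad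 q^\gamma\neq1.$$ (iii) For $q^\beta\neq 1,q^{-1},q^{-2},\dots$, write $\mathbf{\Phi}_3(x,y)=\mathbf{\Phi}_{3}(q^{\alpha};q^{\beta};q,x,y)$ and $\mathbf{\Phi}_3^{+}(x,y)=\mathbf{\Phi}_{3}(q^{\alpha};q^{\beta+1};q,x,y)$. Then $$\mathbb{D}_{\alpha,q}\mathbf{\Phi}_{3}=-\frac{1}{1-q^{\alpha}}\mathbf{\Theta}_{x,q}\mathbf{\Phi}_{3}(x,y),\quad q^\alpha\neq1,$$ $$\mathbb{D}_{\beta,q}\mathbf{\Phi}_{3}=\frac{1}{1-q^{\beta}}\Big[\mathbf{\Theta}_{x,q}\mathbf{\Phi}_{3}^{+}(x,y)+\mathbf{\Theta}_{y,q}\mathbf{\Phi}_{3}^{+}(qx,y)\Big],\quad q^\beta\neq1,$$ $$\mathbb{D}_{\beta,q}\mathbf{\Phi}_{3}=\frac{1}{1-q^{\beta}}\Big[\mathbf{\Theta}_{y,q}\mathbf{\Phi}_{3}^{+}(x,y)+\mathbf{\Theta}_{x,q}\mathbf{\Phi}_{3}^{+}(x,qy)\Big],\quad q^\beta\neq1.$$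
   Context: Let $q\in\mathbb{C}$ with $0<|q|<1$. The $q$-shifted factorial is $(a;q)_0=1$, $(a;q)_\ell=\prod_{j=0}^{\ell-1}(1-aq^j)$ for $\ell\ge 1$. The basic Humbert hypergeometric functions are defined by the double series $$\mathbf{\Phi}_{1}(q^{\alpha},q^{\beta};q^{\gamma};q,x,y)=\sum_{n,k=0}^{\infty}\frac{(q^{\alpha};q)_{n+k}(q^{\beta};q)_{n}}{(q^{\gamma};q)_{n+k}(q;q)_{n}(q;q)_{k}}x^{n}y^{k},$$ $$\mathbf{\Phi}_{2}(q^{\alpha},q^{\beta};q^{\gamma};q,x,y)=\sum_{n,k=0}^{\infty}\frac{(q^{\alpha};q)_{n}(q^{\beta};q)_{k}}{(q^{\gamma};q)_{n+k}(q;q)_{n}(q;q)_{k}}x^{n}y^{k},$$ $$\mathbf{\Phi}_{3}(q^{\alpha};q^{\beta};q,x,y)=\sum_{n,k=0}^{\infty}\frac{(q^{\alpha};q)_{n}}{(q^{\beta};q)_{n+k}(q;q)_{n}(q;q)_{k}}x^{n}y^{k},$$ where the denominator parameter ($q^\gamma$ for $\mathbf\Phi_1,\mathbf\Phi_2$; $q^\beta$ for $\mathbf\Phi_3$) is different from $1,q^{-1},q^{-2},\dots$. The Jackson $q$-difference operator is $\mathbb{D}_{z,q}\Psi(z)=\frac{\Psi(z)-\Psi(qz)}{(1-q)z}$, $z\neq 0$. For a parameter $\delta\in\{\alpha,\beta,\gamma\}$, $\mathbb{D}_{\delta,q}$ denotes this operator acting in the variable $z=q^{\delta}$ (everything else fixed):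 $\mathbb{D}_{\delta,q}F=\frac{F(q^{\delta})-F(q^{\delta+1})}{(1-q)q^{\delta}}$. The operators $\mathbf{\Theta}_{x,q}=x\mathbb{D}_{x,q}$, $\mathbf{\Theta}_{y,q}=y\mathbb{D}_{y,q}$ are $\mathbf{\Theta}_{x,q}f(x,y)=\frac{f(x,y)-f(qx,y)}{1-q}$ and $\mathbf{\Theta}_{y,q}f(x,y)=\frac{f(x,y)-f(x,qy)}{1-q}$; an expression such as $\mathbf{\Theta}_{y,q}\mathbf{\Phi}_1(qx,y)$ means $\mathbf{\Theta}_{y,q}$ applied to $(x,y)\mapsto\mathbf{\Phi}_1(qx,y)$. *)

(* Defs.v *)
From Stdlib Require Import Reals Lra Lia.
From Coquelicot Require Import Coquelicot.

Local Open Scope C_scope.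

Definition Cexp (z : C) : C :=
  ((exp (Re z) * cos (Im z))%R, (exp (Re z) * sin (Im z))%R).

(* The complex power q^alpha = exp (alpha * log q), where [logq] is any
   determination of log q, i.e. any complex number with [Cexp logq = q]. *)
Definition qpow (logq alpha : C) : C := Cexp (alpha * logq).

Fixpoint qpoch (a q : C) (l : nat) : C :=
  match l with
  | O => 1
  | S j => qpoch a q j * (1 - a * q ^ j)
  end.

(* Sum of a double series, as the limit of the rectangular partial sums when
   both bounds tend to infinity independently.  It is only used for absolutely
   convergent double series, for which every order of summation agrees. *)
Definition is_double_series (t : nat -> nat -> C) (l : C) : Prop :=
  filterlim (fun p : nat * nat => sum_n (fun n => sum_n (t n) (snd p)) (fst p))
    (filter_prod eventually eventually) (locally l).

Definition DoubleSeries (t : nat -> nat -> C) : C :=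
  iota (T := C_CompleteNormedModule) (is_double_series t).

Definition abs_summable (t : nat -> nat -> C) : Prop :=
  exists M : R, forall N K : nat,
    (sum_n (fun n => sum_n (fun k => Cmod (t n k)) K) N <= M)%R.

(* In the functions below a, b, c stand for the values of the parameters
   q^alpha, q^beta, q^gamma; for Phi3 the denominator parameter q^beta is b. *)
Definition Phi1_term (q a b c x y : C) (n k : nat) : C :=
  qpoch a q (n + k) * qpoch b q n
    / (qpoch c q (n + k) * qpoch q q n * qpoch q q k) * x ^ n * y ^ k.

Definition Phi2_term (q a b c x y : C) (n k : nat) : C :=
  qpoch a q n * qpoch b q k
    / (qpoch c q (n + k) * qpoch q q n * qpoch q q k) * x ^ n * y ^ k.

Definition Phi3_term (q a b x y : C) (n k : nat) : C :=
  qpoch a q n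
    / (qpoch b q (n + k) * qpoch q q n * qpoch q q k) * x ^ n * y ^ k.

Definition Phi1 (q a b c x y : C) : C := DoubleSeries (Phi1_term q a b c x y).
Definition Phi2 (q a b c x y : C) : C := DoubleSeries (Phi2_term q a b c x y).
Definition Phi3 (q a b x y : C) : C := DoubleSeries (Phi3_term q a b x y).

Definition Dq (q : C) (Psi : C -> C) (z : C) : C :=
  (Psi z - Psi (q * z)) / ((1 - q) * z).

(* Theta_x = x D_x and Theta_y = y D_y with the factor x (resp. y) cancelled,
   so that they also make sense at x = 0 (resp. y = 0). *)
Definition Theta_x (q : C) (f : C -> C -> C) (x y : C) : C :=
  (f x y - f (q * x) y) / (1 - q).

Definition Theta_y (q : C) (f : C -> C -> C) (x y : C) : C :=
  (f x y - f x (q * y)) / (1 - q).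

(* The three double series converge absolutely for |x| < 1 and |y| < 1. *)

Lemma ratio_bound (rho : R) (N : nat) : (1 <= rho)%R ->
  forall u : nat -> R, (forall n, 0 <= u n)%R ->
  (forall n, (N <= n)%nat -> u (S n) <= rho * u n)%R ->
  exists M : R, (0 <= M)%R /\ forall n, (u n <= M * rho ^ n)%R.
Proof.
intros Hr; induction N as [|N IH]; intros u Hu Hs.
- exists (u 0%nat); split; [apply Hu|].
  induction n as [|n IHn]; simpl; [lra|].
  apply Rle_trans with (1 := Hs n (Nat.le_0_l n)); nra.
- destruct (IH (fun n => u (S n)) (fun n => Hu (S n))) as [M [HM Hb]].
  { intros n Hn; apply Hs; lia. }
  exists (Rmax M (u 0%nat)); split; [apply Rle_trans with (1 := HM), Rmax_l|].
  intros [|n]; simpl.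
  + rewrite Rmult_1_r; apply Rmax_r.
  + apply Rle_trans with (1 := Hb n).
    apply Rmult_le_compat; [lra|apply pow_le; lra|apply Rmax_l|].
    assert (0 <= rho ^ n)%R by (apply pow_le; lra); nra.
Qed.

Lemma qpoch_neq0 (c q : C) (n : nat) :
  (forall j, c * q ^ j <> 1) -> qpoch c q n <> 0.
Proof.
intros Hc; induction n as [|n IH]; simpl.
- intro E; injection E; lra.
- apply Cmult_neq_0; [exact IH|].
  intro E; apply (Hc n).
  replace (c * q ^ n) with (1 - (1 - c * q ^ n)) by ring; rewrite E; ring.
Qed.

Lemma Cmod_pow (q : C) (n : nat) : Cmod (q ^ n) = (Cmod q ^ n)%R.
Proof.
induction n as [|n IH]; simpl; [apply Cmod_1|now rewrite Cmod_mult, IH].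
Qed.

Lemma qpoch_ratio_bound (q a c : C) (rho : R) : (Cmod q < 1)%R ->
  (1 < rho)%R -> (forall j, c * q ^ j <> 1) ->
  exists M : R, (0 <= M)%R /\
    forall n, (Cmod (qpoch a q n / qpoch c q n) <= M * rho ^ n)%R.
Proof.
intros Hq Hr Hc.
set (e := ((rho - 1) / (rho + 1))%R).
assert (He : (0 < e)%R) by (apply Rdiv_lt_0_compat; lra).
assert (Hre : (1 + e = rho * (1 - e))%R) by (unfold e; field; lra).
assert (Hev : forall z : C, exists N, forall n, (N <= n)%nat ->
  (Cmod (z * q ^ n) <= e)%R).
{ intros z.
  assert (Hz : (0 < Cmod z + 1)%R) by (generalize (Cmod_ge_0 z); lra).
  destruct (pow_lt_1_zero (Cmod q)) with (y := (e / (Cmod z + 1))%R)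
    as [N HN].
  - rewrite Rabs_pos_eq; [exact Hq|apply Cmod_ge_0].
  - now apply Rdiv_lt_0_compat.
  - exists N; intros n Hn.
    rewrite Cmod_mult, Cmod_pow.
    specialize (HN n Hn); rewrite Rabs_pos_eq in HN
      by (apply pow_le, Cmod_ge_0).
    apply Rmult_lt_compat_r with (1 := Hz) in HN.
    replace (e / (Cmod z + 1) * (Cmod z + 1))%R with e in HN by (field; lra).
    generalize (pow_le _ n (Cmod_ge_0 q)); nra. }
destruct (Hev a) as [Na Ha], (Hev c) as [Nc Hc'].
apply (ratio_bound rho (Na + Nc)); [lra|intros; apply Cmod_ge_0|].
intros n Hn; simpl.
assert (H1 : 1 - c * q ^ n <> 0).
{ intro E; apply (Hc n).
  replace (c * q ^ n) with (1 - (1 - c * q ^ n)) by ring; rewrite E; ring. }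
assert (H2 := qpoch_neq0 c q n Hc).
replace (qpoch a q n * (1 - a * q ^ n) / (qpoch c q n * (1 - c * q ^ n)))
  with ((1 - a * q ^ n) / (1 - c * q ^ n) * (qpoch a q n / qpoch c q n))
  by (field; now split).
rewrite Cmod_mult; apply Rmult_le_compat_r; [apply Cmod_ge_0|].
rewrite Cmod_div by exact H1.
assert (Ba : (Cmod (1 - a * q ^ n) <= 1 + e)%R).
{ apply Rle_trans with (1 := Cmod_triangle _ _).
  rewrite Cmod_1, Cmod_opp; generalize (Ha n ltac:(lia)); lra. }
assert (Bc : (1 - e <= Cmod (1 - c * q ^ n))%R).
{ generalize (Cmod_triangle (1 - c * q ^ n) (c * q ^ n)) (Hc' n ltac:(lia)).
  replace (1 - c * q ^ n + c * q ^ n) with (RtoC 1) by ring.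
  rewrite Cmod_1; lra. }
assert (0 < Cmod (1 - c * q ^ n))%R by (now apply Cmod_gt_0).
apply Rmult_le_reg_r with (Cmod (1 - c * q ^ n)); [assumption|].
unfold Rdiv; rewrite Rmult_assoc, Rinv_l by lra; nra.
Qed.

Lemma geom_sum_le (r : R) (N : nat) : (0 <= r < 1)%R ->
  (sum_n (fun n => r ^ n) N <= / (1 - r))%R.
Proof.
intros Hr; rewrite sum_n_Reals, tech3 by lra.
apply Rmult_le_reg_r with (1 - r)%R; [lra|].
unfold Rdiv; rewrite Rmult_assoc, Rinv_l by lra.
generalize (pow_le r (S N) (proj1 Hr)); lra.
Qed.

Lemma geometric_abs_summable (t : nat -> nat -> C) (M r s : R) :
  (0 <= M)%R -> (0 <= r < 1)%R -> (0 <= s < 1)%R ->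
  (forall n k, (Cmod (t n k) <= M * r ^ n * s ^ k)%R) -> abs_summable t.
Proof.
intros HM Hr Hs Ht; exists (M * / (1 - s) * / (1 - r))%R; intros N K.
assert (Hs' : (0 < / (1 - s))%R) by (apply Rinv_0_lt_compat; lra).
apply Rle_trans with (sum_n (fun n => M * / (1 - s) * r ^ n)%R N).
- rewrite !sum_n_Reals; apply sum_Rle; intros n _.
  apply Rle_trans with (sum_n (fun k => M * r ^ n * s ^ k)%R K).
  + rewrite !sum_n_Reals; apply sum_Rle; intros k _; apply Ht.
  + rewrite (sum_n_mult_l (K := R_Ring) (M * r ^ n)%R (fun k => s ^ k)%R).
    change mult with Rmult.
    assert (H0 : (0 <= M * r ^ n)%R) by (apply Rmult_le_pos, pow_le; lra).
    apply Rle_trans with (1 := Rmult_le_compat_l _ _ _ H0 (geom_sum_le s K Hs)).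
    apply Req_le; ring.
- rewrite (sum_n_mult_l (K := R_Ring) (M * / (1 - s))%R (fun n => r ^ n)%R).
  change mult with Rmult.
  apply Rmult_le_compat_l, geom_sum_le, Hr.
  apply Rmult_le_pos; lra.
Qed.

Lemma product_abs_summable (t : nat -> nat -> C) (u v w : nat -> C) (x y : C) :
  (Cmod x < 1)%R -> (Cmod y < 1)%R ->
  (forall z : nat -> C, z = u \/ z = v \/ z = w -> forall rho : R, (1 < rho)%R ->
     exists M : R, (0 <= M)%R /\ forall n, (Cmod (z n) <= M * rho ^ n)%R) ->
  (forall n k, t n k = u (n + k)%nat * v n * w k * x ^ n * y ^ k) ->
  abs_summable t.
Proof.
intros Hx Hy Hb Ht.
set (m := Rmax (Cmod x) (Cmod y)).
assert (Hmx : (Cmod x <= m)%R) by apply Rmax_l.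
assert (Hmy : (Cmod y <= m)%R) by apply Rmax_r.
assert (Hm : (m < 1)%R) by now apply Rmax_lub_lt.
assert (X0 := Cmod_ge_0 x); assert (Y0 := Cmod_ge_0 y).
set (rho := (1 + (1 - m) / 4)%R).
assert (Hr : (1 < rho)%R) by (unfold rho; lra).
assert (Hrm : (rho * rho * m < 1)%R) by (unfold rho; nra).
destruct (Hb u (or_introl eq_refl) rho Hr) as [A [A0 HA]].
destruct (Hb v (or_intror (or_introl eq_refl)) rho Hr) as [B [B0 HB]].
destruct (Hb w (or_intror (or_intror eq_refl)) rho Hr) as [D [D0 HD]].
assert (AB0 : (0 <= A * B)%R) by now apply Rmult_le_pos.
apply (geometric_abs_summable t (A * B * D)
  (rho * rho * Cmod x) (rho * rho * Cmod y)).
- now apply Rmult_le_pos.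
- split; nra.
- split; nra.
- intros n k; rewrite Ht, !Cmod_mult, !Cmod_pow, !Rpow_mult_distr.
  assert (Xn := pow_le _ n X0); assert (Yk := pow_le _ k Y0).
  replace (A * B * D * (rho ^ n * rho ^ n * Cmod x ^ n)
      * (rho ^ k * rho ^ k * Cmod y ^ k))%R
    with ((A * rho ^ (n + k)) * (B * rho ^ n) * (D * rho ^ k)
      * Cmod x ^ n * Cmod y ^ k)%R by (rewrite pow_add; ring).
  repeat apply Rmult_le_compat_r; trivial.
  repeat apply Rmult_le_compat; trivial using Cmod_ge_0, Rmult_le_pos.
  apply Rmult_le_pos; apply Cmod_ge_0.
Qed.

Lemma qpoch_0 (q : C) (n : nat) : qpoch 0 q n = 1.
Proof. induction n as [|n IH]; simpl; [easy|rewrite IH; ring]. Qed.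

Lemma q_mul_pow_neq1 (q : C) : (Cmod q < 1)%R -> forall j, q * q ^ j <> 1.
Proof.
intros Hq j E; apply (f_equal Cmod) in E.
rewrite Cmod_mult, Cmod_pow, Cmod_1 in E.
assert (H0 := Cmod_ge_0 q).
assert (Cmod q ^ j <= 1)%R by (rewrite <- (pow1 j); apply pow_incr; lra).
assert (0 <= Cmod q ^ j)%R by now apply pow_le.
nra.
Qed.

Lemma denominator_neq1 (q c : C) : (0 < Cmod q)%R ->
  (forall n, c <> / q ^ n) -> forall j, c * q ^ j <> 1.
Proof.
intros Hq Hc j E; apply (Hc j).
assert (q ^ j <> 0) by (apply Cpow_nz; now apply Cmod_gt_0).
replace (/ q ^ j) with (1 * / q ^ j) by ring; rewrite <- E; field; trivial.
Qed.

Lemma Phi1_abs_summable (q a b c x y : C) :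
  (0 < Cmod q)%R -> (Cmod q < 1)%R -> (Cmod x < 1)%R -> (Cmod y < 1)%R ->
  (forall n, c <> / q ^ n) -> abs_summable (Phi1_term q a b c x y).
Proof.
intros Hq0 Hq1 Hx Hy Hc.
assert (qq := fun n => qpoch_neq0 q q n (q_mul_pow_neq1 q Hq1)).
assert (qc := fun n => qpoch_neq0 c q n (denominator_neq1 q c Hq0 Hc)).
apply (product_abs_summable _ (fun m => qpoch a q m / qpoch c q m)
  (fun n => qpoch b q n / qpoch q q n) (fun k => qpoch 0 q k / qpoch q q k)
  x y Hx Hy).
- intros z [-> | [-> | ->]] rho Hr; apply qpoch_ratio_bound;
    auto using q_mul_pow_neq1, denominator_neq1.
- intros n k; unfold Phi1_term; rewrite !qpoch_0; field; auto.
Qed.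

Lemma Phi2_abs_summable (q a b c x y : C) :
  (0 < Cmod q)%R -> (Cmod q < 1)%R -> (Cmod x < 1)%R -> (Cmod y < 1)%R ->
  (forall n, c <> / q ^ n) -> abs_summable (Phi2_term q a b c x y).
Proof.
intros Hq0 Hq1 Hx Hy Hc.
assert (qq := fun n => qpoch_neq0 q q n (q_mul_pow_neq1 q Hq1)).
assert (qc := fun n => qpoch_neq0 c q n (denominator_neq1 q c Hq0 Hc)).
apply (product_abs_summable _ (fun m => qpoch 0 q m / qpoch c q m)
  (fun n => qpoch a q n / qpoch q q n) (fun k => qpoch b q k / qpoch q q k)
  x y Hx Hy).
- intros z [-> | [-> | ->]] rho Hr; apply qpoch_ratio_bound;
    auto using q_mul_pow_neq1, denominator_neq1.
- intros n k; unfold Phi2_term; rewrite !qpoch_0; field; auto.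
Qed.

Lemma Phi3_abs_summable (q a c x y : C) :
  (0 < Cmod q)%R -> (Cmod q < 1)%R -> (Cmod x < 1)%R -> (Cmod y < 1)%R ->
  (forall n, c <> / q ^ n) -> abs_summable (Phi3_term q a c x y).
Proof.
intros Hq0 Hq1 Hx Hy Hc.
assert (qq := fun n => qpoch_neq0 q q n (q_mul_pow_neq1 q Hq1)).
assert (qc := fun n => qpoch_neq0 c q n (denominator_neq1 q c Hq0 Hc)).
apply (product_abs_summable _ (fun m => qpoch 0 q m / qpoch c q m)
  (fun n => qpoch a q n / qpoch q q n) (fun k => qpoch 0 q k / qpoch q q k)
  x y Hx Hy).
- intros z [-> | [-> | ->]] rho Hr; apply qpoch_ratio_bound;
    auto using q_mul_pow_neq1, denominator_neq1.
- intros n k; unfold Phi3_term; rewrite !qpoch_0; field; auto.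
Qed.

(* Main.v *)
(* Write [e = e n k] for the length of the shifted factorial carrying the
   parameter.  Since [(qa;q)_e = (1 - a q^e) / (1 - a) * (a;q)_e], the terms of
   the series satisfy [T(a) - T(qa) = - a / (1 - a) * (1 - q^e) T(a)], and
   [q^e T(a)] is the term at [(qx, y)], [(x, qy)] or [(qx, qy)].  When
   [e = n + k], the two Theta contributions telescope to
   [(F(x, y) - F(qx, qy)) / (1 - q)].  A denominator parameter is the same
   identity with the roles of [T(c)] and [T(qc)] exchanged.  All multipliers
   involved are bounded, so absolute summability at the given point is enough
   for every series that occurs. *)

Require Import Defs.
From Stdlib Require Import Reals Lra Lia.
From Coquelicot Require Import Coquelicot.

Local Open Scope C_scope.

(** * Convergence of real double series along rectangles *)

Lemma sum_n_nonneg_incr (a : nat -> R) (N N' : nat) :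
  (forall n, 0 <= a n)%R -> (N <= N')%nat -> (sum_n a N <= sum_n a N')%R.
Proof.
intros Ha H; induction H as [|N' H IH]; [lra|].
rewrite sum_Sn; change plus with Rplus; specialize (Ha (S N')); lra.
Qed.

Lemma sum_n_nonneg (a : nat -> R) (N : nat) :
  (forall n, 0 <= a n)%R -> (0 <= sum_n a N)%R.
Proof.
intros Ha; apply Rle_trans with (sum_n a 0).
- rewrite sum_O; apply Ha.
- apply sum_n_nonneg_incr; [exact Ha|lia].
Qed.

Lemma sum_n_le (a b : nat -> R) (N : nat) :
  (forall n, a n <= b n)%R -> (sum_n a N <= sum_n b N)%R.
Proof. intros H; rewrite !sum_n_Reals; apply sum_Rle; intros; apply H. Qed.

(** The rectangular partial sums increase in each bound separately, so their supremum is the joint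
    limit. *)
Lemma nonneg_double_series_converges (a : nat -> nat -> R) (M : R) :
  (forall n k, 0 <= a n k)%R ->
  (forall N K, sum_n (fun n => sum_n (a n) K) N <= M)%R ->
  exists l : R,
    filterlim (fun p : nat * nat => sum_n (fun n => sum_n (a n) (snd p)) (fst p))
      (filter_prod eventually eventually) (locally l).
Proof.
intros Ha HM.
set (E := fun r => exists N K, r = sum_n (fun n => sum_n (a n) K) N).
destruct (completeness E) as [l [Hub Hlub]].
- exists M; intros r [N [K ->]]; apply HM.
- exists (sum_n (fun n => sum_n (a n) 0) 0); now exists 0%nat, 0%nat.
- exists l; apply filterlim_locally; intros eps.
  (* Either some rectangle already exceeds [l - eps], and then so do all larger ones, or [l - eps]
     is an upper bound below the least one. *)
  destruct (Classical_Prop.classic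
    (exists N K, (l - eps < sum_n (fun n => sum_n (a n) K) N)%R))
    as [[N [K H]]|H].
  + exists (fun n => (N <= n)%nat) (fun k => (K <= k)%nat);
      [now exists N|now exists K|].
    intros n k Hn Hk; simpl.
    assert (H1 : (sum_n (fun i => sum_n (a i) k) n <= l)%R)
      by (apply Hub; now exists n, k).
    assert (H2 : (sum_n (fun i => sum_n (a i) K) N
      <= sum_n (fun i => sum_n (a i) k) n)%R).
    { apply Rle_trans with (sum_n (fun i => sum_n (a i) k) N).
      - apply sum_n_le; intros i; now apply sum_n_nonneg_incr.
      - apply sum_n_nonneg_incr; [intros i; now apply sum_n_nonneg|exact Hn]. }
    change (Rabs (sum_n (fun i => sum_n (a i) k) n - l) < eps)%R.
    apply Rabs_def1; generalize (cond_pos eps); lra.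
  + exfalso.
    assert (l <= l - eps)%R; [|generalize (cond_pos eps); lra].
    apply Hlub; intros r [N [K ->]].
    apply Rnot_lt_le; intro H'; apply H; now exists N, K.
Qed.

(** Writes [a] as [(a + |a|) - |a|], a difference of two nonnegative families with bounded partial
    sums. *)
Lemma abs_double_series_converges (a : nat -> nat -> R) (M : R) :
  (forall N K, sum_n (fun n => sum_n (fun k => Rabs (a n k)) K) N <= M)%R ->
  exists l : R,
    filterlim (fun p : nat * nat => sum_n (fun n => sum_n (a n) (snd p)) (fst p))
      (filter_prod eventually eventually) (locally l).
Proof.
intros HM.
destruct (nonneg_double_series_converges (fun n k => Rabs (a n k)) M)
  as [l1 H1]; [intros; apply Rabs_pos|exact HM|].
assert (Hsum : forall N K,
  sum_n (fun n => sum_n (fun k => a n k + Rabs (a n k))%R K) N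
  = (sum_n (fun n => sum_n (a n) K) N
     + sum_n (fun n => sum_n (fun k => Rabs (a n k)) K) N)%R).
{ intros N K; rewrite <- (sum_n_plus (G := R_AbelianMonoid)).
  apply sum_n_ext; intros n; now rewrite <- (sum_n_plus (G := R_AbelianMonoid)). }
destruct (nonneg_double_series_converges (fun n k => a n k + Rabs (a n k))%R
  (M + M)) as [l2 H2].
- intros n k; generalize (Rle_abs (- a n k)); rewrite Rabs_Ropp; lra.
- intros N K; rewrite Hsum; apply Rplus_le_compat; [|apply HM].
  apply Rle_trans with (2 := HM N K).
  apply sum_n_le; intros n; apply sum_n_le; intros k; apply Rle_abs.
- exists (l2 - l1)%R.
  apply filterlim_ext with (fun p : nat * nat =>
    plus (sum_n (fun n => sum_n (fun k => a n k + Rabs (a n k))%R (snd p)) (fst p))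
    (opp (sum_n (fun n => sum_n (fun k => Rabs (a n k)) (snd p)) (fst p)))).
  { intros p; rewrite Hsum; unfold plus, opp; simpl; ring. }
  apply (filterlim_comp_2 _ _ plus H2 (filterlim_comp _ _ _ _ opp _ _ _ H1
    (filterlim_opp (V := R_NormedModule) l1))
    (filterlim_plus (V := R_NormedModule) l2 (- l1)%R)).
Qed.

(** * Complex double series: existence, uniqueness and linearity of the sum *)

Lemma sum_n_pair (u : nat -> C) (N : nat) :
  sum_n u N = (sum_n (fun n => Re (u n)) N, sum_n (fun n => Im (u n)) N).
Proof.
induction N as [|N IH].
- rewrite !sum_O; now destruct (u 0%nat).
- now rewrite !sum_Sn, IH.
Qed.

Lemma double_sum_n_pair (t : nat -> nat -> C) (N K : nat) :
  sum_n (fun n => sum_n (t n) K) N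
  = (sum_n (fun n => sum_n (fun k => Re (t n k)) K) N,
     sum_n (fun n => sum_n (fun k => Im (t n k)) K) N).
Proof.
rewrite sum_n_pair; f_equal; apply sum_n_ext; intros n; now rewrite sum_n_pair.
Qed.

Lemma is_double_series_unique (t : nat -> nat -> C) (l : C) :
  is_double_series t l -> DoubleSeries t = l.
Proof. apply (iota_filterlim_locally (V := C_CompleteNormedModule)). Qed.

(** Real and imaginary parts are dominated by the modulus, so both converge; uniqueness of limits
    then identifies the value chosen by [iota]. *)
Lemma DoubleSeries_correct (t : nat -> nat -> C) :
  abs_summable t -> is_double_series t (DoubleSeries t).
Proof.
intros [M HM].
destruct (abs_double_series_converges (fun n k => Re (t n k)) M) as [l1 H1].
{ intros N K; apply Rle_trans with (2 := HM N K).
  apply sum_n_le; intros n; apply sum_n_le; intros k.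
  apply Rle_trans with (2 := Rmax_Cmod (t n k)), Rmax_l. }
destruct (abs_double_series_converges (fun n k => Im (t n k)) M) as [l2 H2].
{ intros N K; apply Rle_trans with (2 := HM N K).
  apply sum_n_le; intros n; apply sum_n_le; intros k.
  apply Rle_trans with (2 := Rmax_Cmod (t n k)), Rmax_r. }
assert (H : is_double_series t (l1, l2)).
{ apply filterlim_ext with (fun p : nat * nat =>
    (sum_n (fun n => sum_n (fun k => Re (t n k)) (snd p)) (fst p),
     sum_n (fun n => sum_n (fun k => Im (t n k)) (snd p)) (fst p))).
  { intros p; now rewrite double_sum_n_pair. }
  (* A ball of [C_UniformSpace] is a product of balls in the two coordinates, so coordinatewise
     convergence is enough. *)
  apply (filterlim_locally (U := C_UniformSpace) _ (l1, l2)); intros eps.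
  apply (filter_and _ _ (proj1 (filterlim_locally _ _) H1 eps)
    (proj1 (filterlim_locally _ _) H2 eps)). }
now rewrite (is_double_series_unique t (l1, l2)).
Qed.

Lemma is_double_series_plus (t u : nat -> nat -> C) (l m : C) :
  is_double_series t l -> is_double_series u m ->
  is_double_series (fun n k => t n k + u n k) (l + m).
Proof.
intros Ht Hu.
apply filterlim_ext with (fun p : nat * nat =>
  plus (sum_n (fun n => sum_n (t n) (snd p)) (fst p))
       (sum_n (fun n => sum_n (u n) (snd p)) (fst p))).
{ intros p; rewrite <- sum_n_plus; apply sum_n_ext; intros n.
  now rewrite <- sum_n_plus. }
apply (filterlim_comp_2 _ _ plus Ht Hu (filterlim_plus (V := C_NormedModule) l m)).
Qed.

Lemma is_double_series_scal (t : nat -> nat -> C) (s l : C) :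
  is_double_series t l -> is_double_series (fun n k => s * t n k) (s * l).
Proof.
intros Ht.
apply filterlim_ext with (fun p : nat * nat =>
  scal s (sum_n (fun n => sum_n (t n) (snd p)) (fst p))).
{ intros p; change (scal s ?z) with (mult s z).
  rewrite <- (sum_n_mult_l (K := C_Ring)); apply sum_n_ext; intros n.
  now rewrite <- (sum_n_mult_l (K := C_Ring)). }
apply (filterlim_comp _ _ _ _ (fun z : C_NormedModule => scal s z) _ _ _ Ht
  (filterlim_scal_r (V := C_NormedModule) s l)).
Qed.

(** * Bounded multipliers preserve absolute summability; bounds for the multipliers that occur *)

Lemma abs_summable_mul (m t u : nat -> nat -> C) (B : R) :
  (forall n k, Cmod (m n k) <= B)%R -> (forall n k, u n k = m n k * t n k) ->
  abs_summable t -> abs_summable u.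
Proof.
intros Hm Hu [M HM].
assert (HB : (0 <= B)%R)
  by (apply Rle_trans with (2 := Hm 0%nat 0%nat), Cmod_ge_0).
exists (B * M)%R; intros N K.
apply Rle_trans with (2 := Rmult_le_compat_l _ _ _ HB (HM N K)).
rewrite <- (sum_n_mult_l (K := R_Ring) B); apply sum_n_le; intros n.
rewrite <- (sum_n_mult_l (K := R_Ring) B); apply sum_n_le; intros k.
rewrite Hu, Cmod_mult; apply Rmult_le_compat_r; [apply Cmod_ge_0|apply Hm].
Qed.

Lemma Cmod_pow_le1 (q : C) (n : nat) : (Cmod q <= 1)%R -> (Cmod (q ^ n) <= 1)%R.
Proof.
intros Hq; rewrite Cmod_pow, <- (pow1 n).
apply pow_incr; split; [apply Cmod_ge_0|exact Hq].
Qed.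

Lemma eventually_bounded (u : nat -> R) (B : R) (N : nat) :
  (forall n, (N <= n)%nat -> (u n <= B)%R) -> exists B', forall n, (u n <= B')%R.
Proof.
revert B; induction N as [|N IH]; intros B H.
- exists B; intros n; apply H; lia.
- apply (IH (Rmax B (u N))); intros n Hn.
  destruct (Nat.eq_dec n N) as [->|Hne]; [apply Rmax_r|].
  apply Rle_trans with (2 := Rmax_l _ _), H; lia.
Qed.

Lemma one_minus_neq0 (z : C) : z <> 1 -> 1 - z <> 0.
Proof.
intros Hz E; apply Hz.
replace z with (1 - (1 - z)) by ring; rewrite E; ring.
Qed.

Lemma Cmod_lt1_neq1 (z : C) : (Cmod z < 1)%R -> z <> 1.
Proof. intros H ->; rewrite Cmod_1 in H; lra. Qed.

(** Since [c * q ^ j] tends to 0, the inverses are eventually at most 2 in modulus, and the finitely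
    many earlier ones are finite because no factor vanishes. This controls the passage from the
    series at [c] to the one at [q * c]. *)
Lemma inv_one_minus_bounded (q c : C) : (Cmod q < 1)%R ->
  (forall j, c * q ^ j <> 1) ->
  exists B : R, forall j, (Cmod (/ (1 - c * q ^ j)) <= B)%R.
Proof.
intros Hq Hc.
assert (C0 := Cmod_ge_0 c).
(* This threshold forces [|c q^n| <= 1/2], hence [|1 - c q^n| >= 1/2]; the added 1 keeps it
   meaningful when [c = 0]. *)
destruct (pow_lt_1_zero (Cmod q)) with (y := (/ (2 * (Cmod c + 1)))%R) as [N HN].
- rewrite Rabs_pos_eq; [exact Hq|apply Cmod_ge_0].
- apply Rinv_0_lt_compat; lra.
- apply (eventually_bounded _ 2 N); intros n Hn.
  specialize (HN n Hn); rewrite Rabs_pos_eq in HN by (apply pow_le, Cmod_ge_0).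
  assert (H0 := one_minus_neq0 _ (Hc n)).
  assert (Hs : (Cmod (c * q ^ n) <= / 2)%R).
  { rewrite Cmod_mult, Cmod_pow.
    apply Rmult_lt_compat_l with (r := (Cmod c + 1)%R) in HN; [|lra].
    replace ((Cmod c + 1) * / (2 * (Cmod c + 1)))%R with (/ 2)%R in HN
      by (field; lra).
    generalize (pow_le _ n (Cmod_ge_0 q)); nra. }
  assert (Hl : (/ 2 <= Cmod (1 - c * q ^ n))%R).
  { generalize (Cmod_triangle (1 - c * q ^ n) (c * q ^ n)).
    replace (1 - c * q ^ n + c * q ^ n) with (RtoC 1) by ring.
    rewrite Cmod_1; lra. }
  rewrite Cmod_inv, <- (Rinv_inv 2) by exact H0.
  apply Rinv_le_contravar; lra.
Qed.

(** * The parameter shift for abstract double series, with [e] the length of the shifted factorial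
    and [v] the series at scaled arguments *)

Lemma DoubleSeries_shift (q a : C) (e : nat -> nat -> nat)
    (t u v : nat -> nat -> C) :
  (Cmod q < 1)%R -> a <> 1 -> abs_summable t ->
  (forall n k, u n k = (1 - a * q ^ e n k) / (1 - a) * t n k) ->
  (forall n k, v n k = q ^ e n k * t n k) ->
  DoubleSeries t - DoubleSeries u
  = - a / (1 - a) * (DoubleSeries t - DoubleSeries v).
Proof.
intros Hq Ha Ht Hu Hv.
assert (Ha' := one_minus_neq0 a Ha).
assert (St := DoubleSeries_correct t Ht).
assert (Sv : is_double_series v (DoubleSeries v)).
{ apply DoubleSeries_correct, (abs_summable_mul (fun n k => q ^ e n k) t v 1);
    [|exact Hv|exact Ht].
  intros; apply Cmod_pow_le1; lra. }
(* Splitting the multiplier as [1 / (1 - a) - a / (1 - a) * q^e] makes [u] a linear combination of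
   [t] and [v]. *)
rewrite (is_double_series_unique u (/ (1 - a) * DoubleSeries t
  + - a / (1 - a) * DoubleSeries v)).
- field; exact Ha'.
- apply filterlim_ext with (2 := is_double_series_plus _ _ _ _
    (is_double_series_scal _ _ _ St) (is_double_series_scal _ _ _ Sv)).
  intros p; apply sum_n_ext; intros n; apply sum_n_ext; intros k.
  rewrite Hu, Hv.
  (* The equality is typed in a Coquelicot structure over [C]; restating it in [C] itself lets
     [field] recognise it. *)
  match goal with |- ?l = ?r => change (@eq C l r) end; field; exact Ha'.
Qed.

(** The factor [a] produced by the shift cancels against the [z = a] in the denominator of [Dq],
    leaving [- 1 / (1 - a)]. *)
Lemma Dq_numerator (q a : C) (e : nat -> nat -> nat)
    (T : C -> nat -> nat -> C) (v : nat -> nat -> C) :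
  (Cmod q < 1)%R -> a <> 0 -> a <> 1 -> abs_summable (T a) ->
  (forall n k, T (q * a) n k = (1 - a * q ^ e n k) / (1 - a) * T a n k) ->
  (forall n k, v n k = q ^ e n k * T a n k) ->
  Dq q (fun z => DoubleSeries (T z)) a
  = - (1 / (1 - a)) * ((DoubleSeries (T a) - DoubleSeries v) / (1 - q)).
Proof.
intros Hq Ha0 Ha Ht Hu Hv; unfold Dq.
rewrite (DoubleSeries_shift q a e _ _ v Hq Ha Ht Hu Hv).
field; repeat split; auto using one_minus_neq0, Cmod_lt1_neq1.
Qed.

(** The shift identity is applied with [T (q * c)] as base series and [T c] as the shifted one; this
    exchange accounts for the positive sign and for the parameter [q * c] on the right. *)
Lemma Dq_denominator (q c : C) (e : nat -> nat -> nat)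
    (T : C -> nat -> nat -> C) (v : nat -> nat -> C) :
  (Cmod q < 1)%R -> c <> 0 -> (forall j, c * q ^ j <> 1) -> abs_summable (T c) ->
  (forall n k, T c n k = (1 - c * q ^ e n k) / (1 - c) * T (q * c) n k) ->
  (forall n k, v n k = q ^ e n k * T (q * c) n k) ->
  Dq q (fun z => DoubleSeries (T z)) c
  = 1 / (1 - c) * ((DoubleSeries (T (q * c)) - DoubleSeries v) / (1 - q)).
Proof.
intros Hq Hc0 Hc Ht Hu Hv.
assert (Hc1 : c <> 1) by (intro E; apply (Hc 0%nat); simpl; rewrite E; ring).
destruct (inv_one_minus_bounded q c Hq Hc) as [B HB].
(* Summability is given at [c] only; it passes to [q * c] through the inverse multiplier
   [(1 - c) / (1 - c q^e)], which is bounded. *)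
assert (Ht' : abs_summable (T (q * c))).
{ apply (abs_summable_mul (fun n k => (1 - c) * / (1 - c * q ^ e n k)) (T c) _
    (Cmod (1 - c) * B)); [| |exact Ht].
  - intros n k; rewrite Cmod_mult.
    apply Rmult_le_compat_l; [apply Cmod_ge_0|apply HB].
  - intros n k; rewrite Hu; field; split; auto using one_minus_neq0. }
unfold Dq.
replace (DoubleSeries (T c) - DoubleSeries (T (q * c)))
  with (- (DoubleSeries (T (q * c)) - DoubleSeries (T c))) by ring.
rewrite (DoubleSeries_shift q c e _ _ v Hq Hc1 Ht' Hu Hv).
field; repeat split; auto using one_minus_neq0, Cmod_lt1_neq1.
Qed.

(** * Shifted factorials, complex powers and Theta operators under q-shifts *)

Lemma qpoch_shift (q a : C) (n : nat) : a <> 1 ->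
  qpoch (q * a) q n = (1 - a * q ^ n) / (1 - a) * qpoch a q n.
Proof.
intros Ha; assert (Ha' := one_minus_neq0 a Ha).
(* Replacing [a] by [q * a] trades the first factor [1 - a] for a new last factor [1 - a q^n]. *)
induction n as [|n IH]; simpl; [|rewrite IH]; now field.
Qed.

Lemma Cexp_add (u v : C) : Cexp (u + v) = Cexp u * Cexp v.
Proof.
destruct u as [a b], v as [c d]; unfold Cexp, Cplus, Cmult; simpl.
rewrite exp_plus, cos_plus, sin_plus; f_equal; ring.
Qed.

Lemma Cexp_neq0 (z : C) : Cexp z <> 0.
Proof.
intros E; assert (H : Cexp z * Cexp (- z) = 1).
{ rewrite <- Cexp_add; replace (z + - z) with (RtoC 0) by ring.
  unfold Cexp, RtoC; simpl; rewrite exp_0, cos_0, sin_0; f_equal; ring. }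
rewrite E, Cmult_0_l in H; injection H; lra.
Qed.

(** Links the exponent shift in [Fp] to the multiplicative shift [z -> q z] performed by [Dq], once
    [Cexp logq] is replaced by [q]. *)
Lemma qpow_succ (logq alpha : C) :
  qpow logq (alpha + 1) = Cexp logq * qpow logq alpha.
Proof. unfold qpow; rewrite <- Cexp_add; f_equal; ring. Qed.

(** The intermediate value [f (q * x) y] cancels. In the opposite order [f x (q * y)] cancels and
    the result is the same, so paired equations reduce to one. *)
Lemma Theta_x_then_y (q : C) (f : C -> C -> C) (x y : C) :
  Theta_x q f x y + Theta_y q (fun x' y' => f (q * x') y') x y
  = (f x y - f (q * x) (q * y)) / (1 - q).
Proof. unfold Theta_x, Theta_y, Cdiv; ring. Qed.

Lemma Theta_y_then_x (q : C) (f : C -> C -> C) (x y : C) :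
  Theta_y q f x y + Theta_x q (fun x' y' => f x' (q * y')) x y
  = (f x y - f (q * x) (q * y)) / (1 - q).
Proof. unfold Theta_x, Theta_y, Cdiv; ring. Qed.

(** * Effect of a parameter shift on a single term *)

Lemma Phi1_term_shift_a (q a b c x y : C) (n k : nat) : a <> 1 ->
  Phi1_term q (q * a) b c x y n k
  = (1 - a * q ^ (n + k)) / (1 - a) * Phi1_term q a b c x y n k.
Proof. intros H; unfold Phi1_term; rewrite qpoch_shift by exact H; unfold Cdiv; ring. Qed.

Lemma Phi1_term_shift_b (q a b c x y : C) (n k : nat) : b <> 1 ->
  Phi1_term q a (q * b) c x y n k
  = (1 - b * q ^ n) / (1 - b) * Phi1_term q a b c x y n k.
Proof. intros H; unfold Phi1_term; rewrite qpoch_shift by exact H; unfold Cdiv; ring. Qed.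

Lemma Phi2_term_shift_a (q a b c x y : C) (n k : nat) : a <> 1 ->
  Phi2_term q (q * a) b c x y n k
  = (1 - a * q ^ n) / (1 - a) * Phi2_term q a b c x y n k.
Proof. intros H; unfold Phi2_term; rewrite qpoch_shift by exact H; unfold Cdiv; ring. Qed.

Lemma Phi2_term_shift_b (q a b c x y : C) (n k : nat) : b <> 1 ->
  Phi2_term q a (q * b) c x y n k
  = (1 - b * q ^ k) / (1 - b) * Phi2_term q a b c x y n k.
Proof. intros H; unfold Phi2_term; rewrite qpoch_shift by exact H; unfold Cdiv; ring. Qed.

Lemma Phi3_term_shift_a (q a c x y : C) (n k : nat) : a <> 1 ->
  Phi3_term q (q * a) c x y n k
  = (1 - a * q ^ n) / (1 - a) * Phi3_term q a c x y n k.
Proof. intros H; unfold Phi3_term; rewrite qpoch_shift by exact H; unfold Cdiv; ring. Qed.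

(** The factorial in [c] stands below the fraction bar, so the multiplier lands on the [q * c] side;
    cancelling it requires that no factor of [qpoch c q] vanish. *)
Lemma Phi1_term_shift_denominator (q a b c x y : C) (n k : nat) :
  (Cmod q < 1)%R -> (forall j, c * q ^ j <> 1) ->
  Phi1_term q a b c x y n k
  = (1 - c * q ^ (n + k)) / (1 - c) * Phi1_term q a b (q * c) x y n k.
Proof.
intros Hq Hc.
assert (Hc1 : c <> 1) by (intro E; apply (Hc 0%nat); simpl; rewrite E; ring).
unfold Phi1_term; rewrite qpoch_shift by exact Hc1.
field; repeat split; auto using one_minus_neq0, qpoch_neq0, q_mul_pow_neq1.
Qed.

Lemma Phi2_term_shift_denominator (q a b c x y : C) (n k : nat) :
  (Cmod q < 1)%R -> (forall j, c * q ^ j <> 1) ->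
  Phi2_term q a b c x y n k
  = (1 - c * q ^ (n + k)) / (1 - c) * Phi2_term q a b (q * c) x y n k.
Proof.
intros Hq Hc.
assert (Hc1 : c <> 1) by (intro E; apply (Hc 0%nat); simpl; rewrite E; ring).
unfold Phi2_term; rewrite qpoch_shift by exact Hc1.
field; repeat split; auto using one_minus_neq0, qpoch_neq0, q_mul_pow_neq1.
Qed.

Lemma Phi3_term_shift_denominator (q a c x y : C) (n k : nat) :
  (Cmod q < 1)%R -> (forall j, c * q ^ j <> 1) ->
  Phi3_term q a c x y n k
  = (1 - c * q ^ (n + k)) / (1 - c) * Phi3_term q a (q * c) x y n k.
Proof.
intros Hq Hc.
assert (Hc1 : c <> 1) by (intro E; apply (Hc 0%nat); simpl; rewrite E; ring).
unfold Phi3_term; rewrite qpoch_shift by exact Hc1.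
field; repeat split; auto using one_minus_neq0, qpoch_neq0, q_mul_pow_neq1.
Qed.

(** * Powers of [q] absorbed by scaling the arguments *)

Lemma Phi1_term_scale_x (q a b c x y : C) (n k : nat) :
  Phi1_term q a b c (q * x) y n k = q ^ n * Phi1_term q a b c x y n k.
Proof. unfold Phi1_term; rewrite ?Cpow_add_r, ?Cpow_mult_l; unfold Cdiv; ring. Qed.

Lemma Phi1_term_scale_xy (q a b c x y : C) (n k : nat) :
  Phi1_term q a b c (q * x) (q * y) n k = q ^ (n + k) * Phi1_term q a b c x y n k.
Proof. unfold Phi1_term; rewrite ?Cpow_add_r, ?Cpow_mult_l; unfold Cdiv; ring. Qed.

Lemma Phi2_term_scale_x (q a b c x y : C) (n k : nat) :
  Phi2_term q a b c (q * x) y n k = q ^ n * Phi2_term q a b c x y n k.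
Proof. unfold Phi2_term; rewrite ?Cpow_add_r, ?Cpow_mult_l; unfold Cdiv; ring. Qed.

Lemma Phi2_term_scale_y (q a b c x y : C) (n k : nat) :
  Phi2_term q a b c x (q * y) n k = q ^ k * Phi2_term q a b c x y n k.
Proof. unfold Phi2_term; rewrite ?Cpow_add_r, ?Cpow_mult_l; unfold Cdiv; ring. Qed.

Lemma Phi2_term_scale_xy (q a b c x y : C) (n k : nat) :
  Phi2_term q a b c (q * x) (q * y) n k = q ^ (n + k) * Phi2_term q a b c x y n k.
Proof. unfold Phi2_term; rewrite ?Cpow_add_r, ?Cpow_mult_l; unfold Cdiv; ring. Qed.

Lemma Phi3_term_scale_x (q a c x y : C) (n k : nat) :
  Phi3_term q a c (q * x) y n k = q ^ n * Phi3_term q a c x y n k.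
Proof. unfold Phi3_term; rewrite ?Cpow_add_r, ?Cpow_mult_l; unfold Cdiv; ring. Qed.

Lemma Phi3_term_scale_xy (q a c x y : C) (n k : nat) :
  Phi3_term q a c (q * x) (q * y) n k = q ^ (n + k) * Phi3_term q a c x y n k.
Proof. unfold Phi3_term; rewrite ?Cpow_add_r, ?Cpow_mult_l; unfold Cdiv; ring. Qed.

(** * Assembly of the equations for the three functions *)

Theorem theorem2p5 (q logq : C) (hq0 : (0 < Cmod q)%R) (hq1 : (Cmod q < 1)%R)
    (hlogq : Cexp logq = q) :
  (forall alpha beta gamma x y : C,
    let a := qpow logq alpha in
    let b := qpow logq beta in
    let c := qpow logq gamma in
    let F := Phi1 q a b c in
    let Fp := Phi1 q a b (qpow logq (gamma + 1)) in
    (forall n : nat, c <> / q ^ n) ->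
    abs_summable (Phi1_term q a b c x y) ->
    (a <> 1 ->
      Dq q (fun z => Phi1 q z b c x y) a
      = - (1 / (1 - a))
        * (Theta_x q F x y + Theta_y q (fun x' y' => F (q * x') y') x y)) /\
    (a <> 1 ->
      Dq q (fun z => Phi1 q z b c x y) a
      = - (1 / (1 - a))
        * (Theta_y q F x y + Theta_x q (fun x' y' => F x' (q * y')) x y)) /\
    (b <> 1 ->
      Dq q (fun z => Phi1 q a z c x y) b
      = - (1 / (1 - b)) * Theta_x q F x y) /\
    (c <> 1 ->
      Dq q (fun z => Phi1 q a b z x y) c
      = 1 / (1 - c)
        * (Theta_x q Fp x y + Theta_y q (fun x' y' => Fp (q * x') y') x y)) /\
    (c <> 1 ->
      Dq q (fun z => Phi1 q a b z x y) c
      = 1 / (1 - c)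
        * (Theta_y q Fp x y + Theta_x q (fun x' y' => Fp x' (q * y')) x y)))
  /\
  (forall alpha beta gamma x y : C,
    let a := qpow logq alpha in
    let b := qpow logq beta in
    let c := qpow logq gamma in
    let F := Phi2 q a b c in
    let Fp := Phi2 q a b (qpow logq (gamma + 1)) in
    (forall n : nat, c <> / q ^ n) ->
    abs_summable (Phi2_term q a b c x y) ->
    (a <> 1 ->
      Dq q (fun z => Phi2 q z b c x y) a
      = - (1 / (1 - a)) * Theta_x q F x y) /\
    (b <> 1 ->
      Dq q (fun z => Phi2 q a z c x y) b
      = - (1 / (1 - b)) * Theta_y q F x y) /\
    (c <> 1 ->
      Dq q (fun z => Phi2 q a b z x y) c
      = 1 / (1 - c)
        * (Theta_x q Fp x y + Theta_y q (fun x' y' => Fp (q * x') y') x y)) /\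
    (c <> 1 ->
      Dq q (fun z => Phi2 q a b z x y) c
      = 1 / (1 - c)
        * (Theta_y q Fp x y + Theta_x q (fun x' y' => Fp x' (q * y')) x y)))
  /\
  (forall alpha beta x y : C,
    let a := qpow logq alpha in
    let b := qpow logq beta in
    let F := Phi3 q a b in
    let Fp := Phi3 q a (qpow logq (beta + 1)) in
    (forall n : nat, b <> / q ^ n) ->
    abs_summable (Phi3_term q a b x y) ->
    (a <> 1 ->
      Dq q (fun z => Phi3 q z b x y) a
      = - (1 / (1 - a)) * Theta_x q F x y) /\
    (b <> 1 ->
      Dq q (fun z => Phi3 q a z x y) b
      = 1 / (1 - b)
        * (Theta_x q Fp x y + Theta_y q (fun x' y' => Fp (q * x') y') x y)) /\
    (b <> 1 ->
      Dq q (fun z => Phi3 q a z x y) b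
      = 1 / (1 - b)
        * (Theta_y q Fp x y + Theta_x q (fun x' y' => Fp x' (q * y')) x y))).

Proof.
assert (qpow0 : forall s, qpow logq s <> 0) by (intro; apply Cexp_neq0).
split; [|split].
- intros alpha beta gamma x y a b c F Fp Hden Hs.
  pose proof (denominator_neq1 q _ hq0 Hden) as Hj.
  unfold Fp; rewrite qpow_succ, hlogq; fold c.
  repeat split; intros H; rewrite ?Theta_x_then_y, ?Theta_y_then_x.
  (* After telescoping, both [gamma] equations have the same right side; [Phi1] unfolds to
     [DoubleSeries], so the abstract lemma applies by conversion. *)
  4-5: exact (Dq_denominator q _ (fun n k => n + k)%nat
      (fun z => Phi1_term q a b z x y)
      (Phi1_term q a b (q * c) (q * x) (q * y)) hq1 (qpow0 _) Hj Hs
      (fun n k => Phi1_term_shift_denominator q a b c x y n k hq1 Hj)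
      (Phi1_term_scale_xy q a b (q * c) x y)).
  1-2: exact (Dq_numerator q _ (fun n k => n + k)%nat
      (fun z => Phi1_term q z b c x y)
      (Phi1_term q a b c (q * x) (q * y)) hq1 (qpow0 _) H Hs
      (fun n k => Phi1_term_shift_a q a b c x y n k H)
      (Phi1_term_scale_xy q a b c x y)).
  (* The factorial in [b] has length [n], so only [x] is scaled and [Theta_x] appears directly. *)
  exact (Dq_numerator q _ (fun n _ => n) (fun z => Phi1_term q a z c x y)
      (Phi1_term q a b c (q * x) y) hq1 (qpow0 _) H Hs
      (fun n k => Phi1_term_shift_b q a b c x y n k H)
      (Phi1_term_scale_x q a b c x y)).
- intros alpha beta gamma x y a b c F Fp Hden Hs.
  pose proof (denominator_neq1 q _ hq0 Hden) as Hj.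
  unfold Fp; rewrite qpow_succ, hlogq; fold c.
  repeat split; intros H; rewrite ?Theta_x_then_y, ?Theta_y_then_x.
  3-4: exact (Dq_denominator q _ (fun n k => n + k)%nat
      (fun z => Phi2_term q a b z x y)
      (Phi2_term q a b (q * c) (q * x) (q * y)) hq1 (qpow0 _) Hj Hs
      (fun n k => Phi2_term_shift_denominator q a b c x y n k hq1 Hj)
      (Phi2_term_scale_xy q a b (q * c) x y)).
  1: exact (Dq_numerator q _ (fun n _ => n) (fun z => Phi2_term q z b c x y)
      (Phi2_term q a b c (q * x) y) hq1 (qpow0 _) H Hs
      (fun n k => Phi2_term_shift_a q a b c x y n k H)
      (Phi2_term_scale_x q a b c x y)).
  (* Here the factorial in [b] has length [k], which scales [y] and yields [Theta_y]. *)
  exact (Dq_numerator q _ (fun _ k => k) (fun z => Phi2_term q a z c x y)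
      (Phi2_term q a b c x (q * y)) hq1 (qpow0 _) H Hs
      (fun n k => Phi2_term_shift_b q a b c x y n k H)
      (Phi2_term_scale_y q a b c x y)).
- intros alpha beta x y a b F Fp Hden Hs.
  pose proof (denominator_neq1 q _ hq0 Hden) as Hj.
  unfold Fp; rewrite qpow_succ, hlogq; fold b.
  repeat split; intros H; rewrite ?Theta_x_then_y, ?Theta_y_then_x.
  2-3: exact (Dq_denominator q _ (fun n k => n + k)%nat
      (fun z => Phi3_term q a z x y)
      (Phi3_term q a (q * b) (q * x) (q * y)) hq1 (qpow0 _) Hj Hs
      (fun n k => Phi3_term_shift_denominator q a b x y n k hq1 Hj)
      (Phi3_term_scale_xy q a (q * b) x y)).
  exact (Dq_numerator q _ (fun n _ => n) (fun z => Phi3_term q z b x y)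
      (Phi3_term q a b (q * x) y) hq1 (qpow0 _) H Hs
      (fun n k => Phi3_term_shift_a q a b x y n k H)
      (Phi3_term_scale_x q a b x y)).
Qed.
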